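(* Let $\mathfrak{g} = \bigoplus_{i\in\mathbb{Z}} \mathfrak{g}_i$ be a $\mathbb{Z}$-graded Lie superalgebra over $\mathbb{R}$ with bracket $[\cdot,\cdot]$. Let $p$ be an odd integer and let $\pi\in\mathfrak{g}_p$ satisfy $[\pi,\pi]=0$. Then the map $d_\pi:\mathfrak{g}\to\mathfrak{g}$ defined by $$d_\pi(U) = [\pi,U]\qquad (U\in\mathfrak{g})$$ satisfies $d_\pi(\mathfrak{g}_i)\subset\mathfrak{g}_{i+p}$ for all $i\in\mathbb{Z}$, and $d_\pi\circ d_\pi = 0$.
   Context: A ($\mathbb{Z}$-graded) Lie superalgebra is a real vector space $\mathfrak{g}$ graded by the integers, $\mathfrak{g}=\bigoplus_{j\in\mathbb{Z}}\mathfrak{g}_j$, with an $\mathbb{R}$-bilinear operation $[\cdot,\cdot]$ satisfying, for $X\in\mathfrak{g}_x$, $Y\in\mathfrak{g}_y$, $Z\in\mathfrak{g}_z$: (i) $[\mathfrak{g}_i,\mathfrak{g}_j]\subset\mathfrak{g}_{i+j}$; (ii) $[X,Y]+(-1)^{xy}[Y,X]=0$; (iii) $(-1)^{xz}[[X,Y],Z]+(-1)^{yx}[[Y,Z],X]+(-1)^{zy}[[Z,X],Y]=0$. *)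

(* Defs.v *)
From HB Require Import structures.
From mathcomp Require Import all_boot all_order all_algebra.
From mathcomp Require Import boolp classical_sets functions cardinality fsbigop.
From mathcomp Require Import reals.

Set Implicit Arguments.
Unset Strict Implicit.
Unset Printing Implicit Defensive.

Import GRing.Theory.

Local Open Scope classical_set_scope.
Local Open Scope ring_scope.

Definition linear_subspace (R : realType) (V : lmodType R) (S : set V) : Prop :=
  S 0 /\ forall (a : R) (u v : V), S u -> S v -> S (a *: u + v).

(* V is the internal direct sum of the subspaces g_ i. Finiteness of the support
   is required explicitly because [\sum_(i \in setT) f i] is 0 by convention
   when f has infinite support. *)
Definition direct_sum_decomposition (R : realType) (V : lmodType R)
    (g_ : int -> set V) : Prop :=
  (forall i, linear_subspace (g_ i)) /\
  forall v : V, exists! f : int -> V,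
    [/\ forall i, g_ i (f i),
        finite_set [set i | f i != 0] &
        v = \sum_(i \in [set: int]) f i].

Record lieSuperalgebra (R : realType) := LieSuperalgebra {
  lsa_carrier :> lmodType R;
  homog : int -> set lsa_carrier;
  bracket : {bilinear lsa_carrier -> lsa_carrier -> lsa_carrier};
  homog_direct_sum : direct_sum_decomposition homog;
  bracket_homog : forall (i j : int) (X Y : lsa_carrier),
    homog i X -> homog j Y -> homog (i + j) (bracket X Y);
  bracket_antisym : forall (x y : int) (X Y : lsa_carrier),
    homog x X -> homog y Y ->
    bracket X Y + (-1) ^ (x * y) *: bracket Y X = 0;
  bracket_jacobi : forall (x y z : int) (X Y Z : lsa_carrier),
    homog x X -> homog y Y -> homog z Z ->
    (-1) ^ (x * z) *: bracket (bracket X Y) Z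
    + (-1) ^ (y * x) *: bracket (bracket Y Z) X
    + (-1) ^ (z * y) *: bracket (bracket Z X) Y = 0
}.

Arguments homog {R} g i : rename.
Arguments bracket {R} g : rename.

Definition d_ (R : realType) (g : lieSuperalgebra R) (pi : g) : g -> g :=
  fun U => bracket g pi U.

(* Main.v *)
Require Import Defs.
From mathcomp Require Import all_boot all_order all_algebra.
From mathcomp Require Import boolp classical_sets functions reals.

Import GRing.Theory Num.Theory.

Local Open Scope classical_set_scope.
Local Open Scope ring_scope.

(** The Jacobi identity for [(pi, pi, U)] with [U] homogeneous, combined with
    graded antisymmetry of [[pi, U]], reads [- 2 [[pi, U], pi] = 0] because [p]
    is odd and [[pi, pi] = 0]; antisymmetry once more gives
    [[pi, [pi, U]] = 0].  The general case follows by linearity. *)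

Lemma exprN1z_odd (R : unitRingType) (p : int) :
  ~~ (2 %| p)%Z -> (-1 : R) ^ p = -1.
Proof.
rewrite dvdzE dvdn2 negbK; case: p => [n|n] /= n_odd.
  by rewrite -exprnP -signr_odd n_odd.
(* For a negative exponent the power is inverted, and -1 is its own inverse. *)
by rewrite NegzE -exprnN -signr_odd /= n_odd expr1 invrN1.
Qed.

(** Each vector is a finite sum of its homogeneous components, so additive properties need checking
    only on these. *)
Lemma homog_spanning (R : realType) (g : lieSuperalgebra R) (P : g -> Prop) :
  P 0 -> (forall u v, P u -> P v -> P (u + v)) ->
  (forall i u, homog g i u -> P u) -> forall u, P u.
Proof.
move=> P0 PD Ph u; have [_ /(_ u)[f [[fh _ ->] _]]] := homog_direct_sum g.
by apply: (big_ind P) => // i _; apply: Ph (fh i).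
Qed.

Lemma bracket_odd_square0 (R : realType) (g : lieSuperalgebra R) (p u : int)
    (pi U : g) :
  ~~ (2 %| p)%Z -> homog g p pi -> bracket g pi pi = 0 -> homog g u U ->
  bracket g pi (bracket g pi U) = 0.
Proof.
move=> p_odd hpi pipi0 hU.
have antiU := bracket_antisym hpi hU.
have UpiE : (-1) ^ (u * p) *: bracket g U pi = - bracket g pi U.
  by rewrite mulrC; apply/eqP; rewrite -addr_eq0 addrC antiU.
have := bracket_jacobi hpi hpi hU.
(* The sign [(-1) ^ (p * p)] is split as [((-1) ^ p) ^ p], so oddness of [p] applies twice. *)
rewrite pipi0 linear0l scaler0 add0r -(exprz_exp _ p p) !(exprN1z_odd _ _ p_odd) scaleN1r.
(* The remaining sign moves inside the bracket, where [UpiE] absorbs it whatever the parity of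
   [u]. *)
rewrite -linearZl_LR UpiE linearNl -opprD => /eqP.
(* The factor 2 cancels because the scalars have characteristic 0. *)
rewrite oppr_eq0 -mulr2n -scaler_nat scaler_eq0 pnatr_eq0 /= => /eqP piUpi0.
have := bracket_antisym hpi (bracket_homog hpi hU).
by rewrite piUpi0 scaler0 addr0.
Qed.

Theorem proposition2p1 (R : realType) (g : lieSuperalgebra R) (p : int)
    (hp : ~~ (2 %| p)%Z) (pi : g) (hpi : homog g p pi)
    (hpipi : bracket g pi pi = 0) :
  (forall i : int, d_ pi @` homog g i `<=` homog g (i + p)) /\
  d_ pi \o d_ pi = (fun _ : g => 0).
Proof.
split=> [i _ [U hU <-]|]; first by rewrite addrC; apply: bracket_homog.
apply/funext; apply: homog_spanning => [|U V|i U hU]; rewrite /= /d_.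
- by rewrite !linear0r.
- by rewrite !linearDr => -> ->; rewrite addr0.
- exact: bracket_odd_square0 hpi hpipi hU.
Qed.
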